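(* Let $p$ be a prime, let $q\equiv1\pmod p$ be a prime, and let $N\equiv1\pmod p$ be a positive integer such that $\Phi_p(N)=kq$ for some positive integer $k$. Let $d$ be a $p$-th power free integer such that $\gcd(N,pd)=1$ and $d^{\frac{N-1}{p}}\not\equiv1\pmod N$. Let $K=\mathbb{Q}(\sqrt[p]{d})$ with ring of integers $\mathcal{O}_K$, let $\mathcal{R}_N=\mathcal{O}_K/N\mathcal{O}_K$, and let $w\in\mathcal{R}_N^\times$. If $\Phi_q(w^k)=0$ in $\mathcal{R}_N$ and $q>N^{p/2}-1$, then $N$ is prime.
   Context: For a prime $\ell$, $\Phi_\ell(x)=x^{\ell-1}+x^{\ell-2}+\cdots+x+1$ is the $\ell$-th cyclotomic polynomial. The data $(q,d,w)$ satisfying these hypotheses is what the paper calls a valid constructive prime certificate for $N$. *)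

(* Defs.v *)
From HB Require Import structures.
From mathcomp Require Import all_boot all_order all_algebra all_field.
From mathcomp Require Import boolp reals exp.
Set Implicit Arguments.
Unset Strict Implicit.
Unset Printing Implicit Defensive.
Import Order.TTheory GRing.Theory Num.Theory.
Local Open Scope ring_scope.
Local Open Scope quotient_scope.

(* Defined over possibly trivial rings, so that it can be evaluated in O_K / N *)
(* for every N, including N = 1.                                               *)
Definition Phi (R : pzSemiRingType) (l : nat) (x : R) : R := \sum_(i < l) x ^+ i.

Lemma Phi_Cyclotomic (l : nat) : prime l -> 'Phi_l = Phi l ('X : {poly int}).
Proof.
move=> pl.
have P1 : 'Phi_1 = 'X - 1 :> {poly int}.
  by have := @prod_Cyclotomic 1 isT; rewrite big_cons big_nil mulr1.
have P1n0 : ('Phi_1 : {poly int}) != 0 by rewrite monic_neq0 ?Cyclotomic_monic.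
apply: (mulfI P1n0); rewrite {2}P1 -subrX1 -(prod_Cyclotomic (prime_gt0 pl)).
have -> : \prod_(d <- divisors l) 'Phi_d = \prod_(d <- [:: 1; l]%N) 'Phi_d.
  apply: perm_big; apply: uniq_perm; first exact: divisors_uniq.
    by rewrite /= inE eq_sym neq_ltn prime_gt1 // orbT.
  move=> d; rewrite -dvdn_divisors ?prime_gt0 // !inE.
  apply/idP/idP => [|/orP[] /eqP->]; rewrite ?dvd1n ?dvdnn //.
  by case/primeP: pl => _ /[apply].
by rewrite !big_cons big_nil mulr1.
Qed.

Definition power_free (p : nat) (d : int) : Prop :=
  forall r : nat, prime r -> ~~ (r%:Z ^+ p %| d)%Z.

(* K is generated over rat by a p-th root of d.                                *)
Definition is_radical_ext (K : fieldExtType rat) (p : nat) (d : int) : Prop :=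
  exists2 a : K, a ^+ p = d%:~R & <<1; a>>%VS = fullv.

Section RingOfIntegers.
Variable K : fieldExtType rat.

Definition integral_pred : {pred K} :=
  fun x => `[< integralOver (intr : int -> K) x >].

Fact integral_pred_subring : subring_closed integral_pred.
Proof.
split; first by apply/asboolP; apply: integral1.
  by move=> x y /asboolP ix /asboolP iy; apply/asboolP; apply: integral_sub.
by move=> x y /asboolP ix /asboolP iy; apply/asboolP; apply: integral_mul.
Qed.

HB.instance Definition _ :=
  GRing.isSubringClosed.Build K integral_pred integral_pred_subring.

Record ring_of_integers := RingOfIntegers {
  int_val :> K;
  _ : int_val \in integral_pred
}.

HB.instance Definition _ := [isSub for int_val].
HB.instance Definition _ := [Choice of ring_of_integers by <:].
HB.instance Definition _ := [SubChoice_isSubComNzRing of ring_of_integers by <:].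

End RingOfIntegers.

Section Quotient.
Variables (K : fieldExtType rat) (N : nat).
Local Notation OK := (ring_of_integers K).

Definition multiples : {pred OK} := fun x => `[< exists y : OK, x = N%:R * y >].

Fact multiples_zmod_closed : zmod_closed multiples.
Proof.
split; first by apply/asboolP; exists 0; rewrite mulr0.
move=> x y /asboolP[u ->] /asboolP[v ->].
by apply/asboolP; exists (u - v); rewrite mulrBr.
Qed.

HB.instance Definition _ :=
  GRing.isZmodClosed.Build OK multiples multiples_zmod_closed.

Lemma multiplesMl (a x : OK) : x \in multiples -> a * x \in multiples.
Proof.
by move=> /asboolP[y ->]; apply/asboolP; exists (a * y); rewrite mulrCA.
Qed.

(* The library's {ideal_quot _} requires a proper ideal, which N O_K is not    *)
(* for N = 1; hence the additive quotient is endowed here with its product.    *)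
Definition ring_mod : Type := Quotient.quot multiples.

HB.instance Definition _ := GRing.Zmodule.on ring_mod.
HB.instance Definition _ := EqQuotient.on ring_mod.

Definition ring_mod_one : ring_mod := lift_cst ring_mod 1.
Definition ring_mod_mul := lift_op2 ring_mod *%R.

Canonical pi_ring_mod_one := PiConst ring_mod_one.

Lemma pi_ring_mod_mul : {morph \pi_ring_mod : x y / x * y >-> ring_mod_mul x y}.
Proof.
move=> x y; unlock ring_mod_mul; apply/eqP; rewrite piE Quotient.equivE.
set x' := repr _; set y' := repr _.
have xx : x - x' \in multiples by rewrite Quotient.idealrBE reprK.
have yy : y - y' \in multiples by rewrite Quotient.idealrBE reprK.
have -> : x * y - x' * y' = y * (x - x') + x' * (y - y').
  by rewrite !mulrBr addrA (mulrC y x) (mulrC y x') addrNK.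
by rewrite rpredD // multiplesMl.
Qed.
Canonical pi_ring_mod_mul_morph := PiMorph2 pi_ring_mod_mul.

Fact ring_mod_mulA : associative ring_mod_mul.
Proof. by move=> x y z; rewrite -[x]reprK -[y]reprK -[z]reprK !piE mulrA. Qed.

Fact ring_mod_mulC : commutative ring_mod_mul.
Proof. by move=> x y; rewrite -[x]reprK -[y]reprK !piE mulrC. Qed.

Fact ring_mod_mul1 : left_id ring_mod_one ring_mod_mul.
Proof. by move=> x; rewrite -[x]reprK !piE mul1r. Qed.

Fact ring_mod_mulDl : left_distributive ring_mod_mul +%R.
Proof.
move=> x y z; rewrite -[x]reprK -[y]reprK -[z]reprK.
by rewrite -pi_addr -!pi_ring_mod_mul mulrDl pi_addr.
Qed.

HB.instance Definition _ := GRing.Zmodule_isComPzRing.Build ring_mod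
  ring_mod_mulA ring_mod_mulC ring_mod_mul1 ring_mod_mulDl.

End Quotient.

(* GRing.unit is only available in nontrivial rings.                           *)
Definition invertible (R : comPzRingType) (x : R) : Prop := exists y, x * y = 1.

(* Main.v *)
Require Import Defs.
From HB Require Import structures.
From mathcomp Require Import all_boot all_order all_algebra all_field.
From mathcomp Require Import boolp reals exp.
Set Implicit Arguments.
Unset Strict Implicit.
Unset Printing Implicit Defensive.
Import Order.TTheory GRing.Theory Num.Theory.
Local Open Scope ring_scope.

(** Suppose that N is composite and let r be its least prime divisor, so that
    r ^ 2 <= N.  Morally, w ^ k maps to a root x of Phi_q in the residue field
    of a prime of O_K above r; as q <> r, x has order exactly q in a group of
    order r ^ f - 1, where f <= [K : Q] <= p.  Hence
      q <= r ^ p - 1 <= N ^ (p / 2) - 1,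
    which the lower bound on q forbids.  That q <> r follows from
    Phi_p(N) = 1 modulo r, since q divides Phi_p(N).

    The residue field is reached through polynomials only, without primes of
    O_K or an integral basis.  An element u of O_K lifting w ^ k is a root of a
    primitive integer polynomial m of degree at most [K : Q]
    ([primitive_annihilator]), and Phi_q(u) lies in r O_K.  Modulo r, m and
    Phi_q cannot be coprime: a Bezout relation lifted to Z and evaluated at u
    would make r invertible in O_K ([common_root_not_coprimep]), which it is
    not ([natr_OK_not_unit]).  So they share a root x in an extension of F_r,
    and x has degree at most deg m over F_r because m, being primitive, does not
    vanish modulo r.  The bound on q is then [prime_lt_card_root]. *)

Lemma rmorph_Phi (R S : comPzRingType) (f : {rmorphism R -> S}) l (x : R) :
  f (Phi l x) = Phi l (f x).
Proof. by rewrite /Phi rmorph_sum; apply: eq_bigr => i _; rewrite rmorphXn. Qed.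

Lemma horner_Phi (R : comNzRingType) l (x : R) : (Phi l 'X).[x] = Phi l x.
Proof. by rewrite /Phi horner_sum; apply: eq_bigr => i _; rewrite hornerXn. Qed.

Lemma map_Phi (R S : comNzRingType) (f : {rmorphism R -> S}) l :
  map_poly f (Phi l 'X) = Phi l 'X.
Proof. by rewrite rmorph_Phi /= map_polyX. Qed.

Section FiniteField.
Variable F : finFieldType.

Lemma common_root_ext (f g : {poly F}) :
    f != 0 -> ~~ coprimep f g ->
  exists (L : fieldExtType F) (x : L),
    root (map_poly (in_alg L) f) x /\ root (map_poly (in_alg L) g) x.
Proof.
move=> f_neq0 ncop.
have h_neq0: gcdp f g != 0 by rewrite gcdp_eq0 negb_and f_neq0.
have [L [[|x rs] Dh _]] := FinSplittingFieldFor h_neq0.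
  case/negP: ncop; rewrite /coprimep -(size_map_poly (in_alg L)).
  by rewrite (eqp_size Dh) big_nil size_poly1.
have hx: root (map_poly (in_alg L) (gcdp f g)) x.
  by rewrite (eqp_root Dh) big_cons rootM root_XsubC eqxx.
exists L, x; move: hx; rewrite gcdp_map.
by rewrite root_gcd => /andP.
Qed.

(** A root x of Phi_q has multiplicative order q when q is nonzero in F, because
    Phi_q(1) = q.  If f has degree e then x lies in an extension E of F of
    degree at most e, so q divides #|E| - 1, which is less than #|F| ^ e. *)
Lemma prime_lt_card_root (L : fieldExtType F) (x : L) (f : {poly F}) (q : nat) :
    prime q -> (q%:R : F) != 0 -> Phi q x = 0 ->
    f != 0 -> root (map_poly (in_alg L) f) x ->
  (q < #|F| ^ (size f).-1)%N.
Proof.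
move=> q_pr q_neq0 Phi0 f_neq0 fx.
have x_neq1: x != 1.
  apply: contra_neq q_neq0 => x1; apply: (fmorph_inj (in_alg L)).
  rewrite rmorph_nat rmorph0 -Phi0 x1 /Phi.
  by under eq_bigr do rewrite expr1n; rewrite sumr_const card_ord.
have xq: x ^+ q = 1.
  by apply/eqP; rewrite -subr_eq0 subrX1 -[\sum_(i < q) _]/(Phi q x) Phi0 mulr0.
have x_neq0: x != 0.
  apply: contra_eq_neq xq => ->.
  by rewrite expr0n gtn_eqF ?prime_gt0 // eq_sym oner_eq0.
have q_prim: q.-primitive_root x.
  have [m m_prim] := prim_order_exists (prime_gt0 q_pr) xq.
  case/primeP: q_pr => _ /[apply] /orP[] /eqP Dm; last by rewrite -Dm.
  by case/eqP: x_neq1; rewrite -(prim_expr_order m_prim) Dm expr1.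
pose E := <<1%AS; x>>%AS.
have: x ^+ (#|F| ^ \dim E) == x.
  by have := Fermat's_little_theorem E x; rewrite memv_adjoin => <-.
have F_gt1 := finNzRing_gt1 F.
have E_gt0: (0 < #|F| ^ \dim E)%N by rewrite expn_gt0 ltnW.
(* Cancel x in x ^+ #|E| = x to get x ^+ (#|E| - 1) = 1. *)
rewrite -{1}(subnKC E_gt0) exprD expr1 -[X in _ == X]mulr1.
rewrite (inj_eq (mulfI x_neq0)).
rewrite -(prim_order_dvd q_prim) => /dvdn_leq.
have dimE: (\dim E <= (size f).-1)%N.
  rewrite dim_Fadjoin dimv1 muln1 -ltnS -size_minPoly prednK ?size_poly_gt0 //.
  rewrite -(size_map_poly (in_alg L)) dvdp_leq ?map_poly_eq0 //.
  by apply: minPoly_dvdp => //; apply/polyOver1P; exists f.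
have dE_gt0: (0 < \dim E)%N by rewrite adim_gt0.
have E_gt1: (1 < #|F| ^ \dim E)%N by rewrite -[1%N](exp1n (\dim E)) ltn_exp2r.
rewrite subn_gt0 => /(_ E_gt1); rewrite leq_subRL // add1n => /leq_trans; apply.
by rewrite leq_exp2l.
Qed.

End FiniteField.

Lemma map_intr_Fp_eq0 (r : nat) (P : {poly int}) : prime r ->
  (map_poly (intr : int -> 'F_r) P == 0) = (r%:Z %| zcontents P)%Z.
Proof.
move=> r_pr; rewrite dvdz_contents; apply/eqP/polyOverP => [P0 i | rP].
  by rewrite (dvdz_pcharf (pchar_Fp r_pr)) -coef_map P0 coef0.
apply/polyP => i; rewrite coef_map coef0; apply/eqP.
by have := rP i; rewrite (dvdz_pcharf (pchar_Fp r_pr)).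
Qed.

Lemma map_intr_Fp_surj (r : nat) (P : {poly 'F_r}) :
  exists Q : {poly int}, map_poly (intr : int -> 'F_r) Q = P.
Proof.
exists (map_poly (fun x : 'F_r => (x : nat)%:Z) P).
rewrite -map_poly_comp ?map_poly_id // => x _.
by rewrite /= -[_%:~R]/(_%:R) natr_Zp.
Qed.

(** A Bezout relation between f and g modulo r lifts to a f + b g = 1 + r C over
    the integers; evaluating it at a root v of f where g takes a multiple of r as
    value shows that 1 is a multiple of r. *)
Lemma common_root_not_coprimep (A : comNzRingType) (v y : A) (r : nat)
    (f g : {poly int}) :
    prime r -> (forall c : A, r%:R * c != 1) ->
    (map_poly intr f).[v] = 0 -> (map_poly intr g).[v] = r%:R * y ->
  ~~ coprimep (map_poly (intr : int -> 'F_r) f) (map_poly (intr : int -> 'F_r) g).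
Proof.
move=> r_pr r_nunit fv gv; apply/negP => /Bezout_coprimepP[[a b] /=].
rewrite -size_poly_eq1 => /size_poly1P[c c_neq0 Dc].
have [a' Da] := map_intr_Fp_surj (c^-1 *: a).
have [b' Db] := map_intr_Fp_surj (c^-1 *: b).
have : map_poly (intr : int -> 'F_r) (a' * f + b' * g - 1) == 0.
  rewrite rmorphB rmorphD !rmorphM /= Da Db rmorph1 -!scalerAl -scalerDr Dc.
  by rewrite -mul_polyC -polyCM mulVf // subrr.
rewrite map_intr_Fp_eq0 // => /dvdzP[z Dz].
have /(congr1 (fun p => (map_poly (intr : int -> A) p).[v])) :=
  zpolyEprim (a' * f + b' * g - 1).
rewrite /= rmorphB rmorphD !rmorphM /= rmorph1 !hornerE fv gv mulr0 add0r Dz.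
rewrite map_polyZ /= hornerZ rmorphM /= -mulrA mulrCA -[(Posz r)%:~R]/(r%:R).
move=> /eqP; rewrite subr_eq addrC -subr_eq (mulrCA z%:~R) -mulrBr.
by apply/negP; apply: r_nunit.
Qed.

Section NumberField.
Variable K : fieldExtType rat.
Local Notation OK := (ring_of_integers K).

(** An inverse of r in O_K would be the rational 1 / r, and a rational number
    that is integral over Z is an integer; the latter fact is borrowed from the
    algebraic integers of [algC]. *)
Lemma natr_OK_not_unit (r : nat) (c : OK) : (1 < r)%N -> r%:R * c != 1.
Proof.
move=> r_gt1; apply/eqP => /(congr1 val).
rewrite rmorphM rmorph_nat rmorph1 /= => rc.
have r_neq0: r%:R != 0 :> K.
  by rewrite -(rmorph_nat (in_alg K)) fmorph_eq0 pnatr_eq0 -lt0n ltnW.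
have Dc: int_val c = in_alg K r%:R^-1.
  by apply: (mulfI r_neq0); rewrite rc fmorphV rmorph_nat divff.
have /asboolP[P P_monic] : int_val c \in integral_pred (K := K).
  by case: c {rc Dc}.
have -> : map_poly (intr : int -> K) P = map_poly (in_alg K) (map_poly intr P).
  rewrite -map_poly_comp; apply: eq_map_poly => z.
  by rewrite [RHS](rmorph_int (in_alg K)).
rewrite Dc fmorph_root -(fmorph_root (ratr : rat -> algC)).
rewrite -map_poly_comp => /root_monic_Aint Ac.
have: (ratr r%:R^-1 : algC) \is a Num.int.
  apply: Cint_rat_Aint; first exact: Crat_rat.
  apply: Ac; first exact: monic_map.
  by apply/polyOverP => i; rewrite coef_map /= rmorph_int intr_int.
case/intrP => z Dz; have: (r%:Z * z)%:~R == 1 :> algC.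
  by rewrite rmorphM /= -Dz fmorphV rmorph_nat divff // pnatr_eq0 -lt0n ltnW.
rewrite -[1]/(1%:~R) eqr_int => /eqP /(congr1 absz); rewrite abszM => /eqP.
by rewrite muln_eq1 gtn_eqF.
Qed.

(** The minimal polynomial over Q, with denominators cleared and content removed.
    Primitivity makes its reduction modulo every prime nonzero. *)
Lemma primitive_annihilator (u : K) :
  exists m : {poly int},
    [/\ zcontents m = 1, (size m <= (\dim {:K}).+1)%N
      & root (map_poly intr m) u].
Proof.
have /polyOver1P[m Dm] := minPolyOver 1%AS u.
have m_neq0: m != 0.
  by have := monic_neq0 (monic_minPoly 1%AS u); rewrite Dm map_poly_eq0.
have [m1 [a a_neq0 Dm1]] := rat_poly_scale m.
have m1_neq0: m1 != 0.
  by apply: contraNneq m_neq0 => m10; rewrite Dm1 m10 rmorph0 scaler0.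
exists (zprimitive m1); split; first by rewrite zcontents_primitive m1_neq0.
  rewrite size_zprimitive.
  have -> : size m1 = size (minPoly 1%AS u).
    rewrite Dm size_map_poly Dm1 size_scale ?invr_eq0 ?intr_eq0 //.
    by rewrite size_map_inj_poly //; apply: intr_inj.
  have := dim_Fadjoin 1%AS u; rewrite dimv1 muln1 => deg_u.
  by rewrite size_minPoly ltnS -deg_u dimvS // subvf.
have aK: in_alg K (a%:~R^-1) != 0 by rewrite fmorph_eq0 invr_eq0 intr_eq0.
have := root_minPoly 1%AS u; rewrite Dm Dm1 map_polyZ (rootZ _ _ aK).
rewrite -map_poly_comp (eq_map_poly (g := intr)); last first.
  by move=> z; apply: (rmorph_int (in_alg K)).
rewrite [in X in X -> _](zpolyEprim m1) map_polyZ /= rootZ //.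
by rewrite -(rmorph_int (in_alg K)) fmorph_eq0 intr_eq0 zcontents_eq0.
Qed.

(** Only an upper bound on [K : Q] holds in general: 'X^p - d may be reducible,
    for instance when d = -1. *)
Lemma dim_radical_ext p d :
  (0 < p)%N -> is_radical_ext K p d -> (\dim {:K} <= p)%N.
Proof.
move=> p_gt0 [a Da <-].
rewrite dim_Fadjoin dimv1 muln1 -ltnS -size_minPoly.
rewrite -(size_XnsubC (d%:~R : K) p_gt0).
apply: dvdp_leq; first by rewrite -size_poly_gt0 size_XnsubC.
apply: minPoly_dvdp; last by rewrite /root !hornerE Da subrr.
by rewrite rpredB ?rpredX ?polyOverX // polyOverC rpred_int.
Qed.

Lemma pi_ring_modX N (u : OK) i :
  (\pi_(ring_mod K N) u : ring_mod K N)%qT ^+ i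
    = (\pi_(ring_mod K N) (u ^+ i))%qT.
Proof.
elim: i => [|i IHi]; first by rewrite !expr0; apply/esym; rewrite piE.
by rewrite !exprS IHi; apply/esym; apply: pi_ring_mod_mul.
Qed.

Lemma Phi_pi_eq0 N l (u : OK) :
  Phi l (\pi_(ring_mod K N) u : ring_mod K N)%qT = 0 ->
  exists y, Phi l u = N%:R * y.
Proof.
rewrite /Phi; under eq_bigr do rewrite pi_ring_modX.
rewrite -(raddf_sum (\pi_(ring_mod K N))%qT).
have pi0 : (\pi_(ring_mod K N) 0)%qT = 0 by rewrite piE.
rewrite -pi0 => /eqP; rewrite -Quotient.idealrBE subr0.
by move/asboolP.
Qed.

End NumberField.

Theorem theorem9p10 (R : realType) (p q N k : nat) (d : int)
    (K : fieldExtType rat) (w : ring_mod K N)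
    (p_prime : prime p)
    (q_prime : prime q) (q_mod : q = 1 %[mod p])
    (N_gt0 : (0 < N)%N) (N_mod : N = 1 %[mod p])
    (k_gt0 : (0 < k)%N) (PhiN : Phi p N%:Z = k%:Z * q%:Z)
    (d_free : power_free p d)
    (gcd_N_pd : gcdz N%:Z (p%:Z * d) = 1)
    (d_pow : (d ^+ ((N - 1) %/ p)%N <> 1 %[mod N%:Z])%Z)
    (K_def : is_radical_ext K p d)
    (w_unit : invertible w)
    (w_root : Phi q (w ^+ k) = 0)
    (q_large : q%:R > N%:R `^ (p%:R / 2) - 1 :> R) :
  prime N.
Proof.
apply: ltn_pdiv2_prime => //; rewrite ltnNge; apply/negP => r2_le_N.
have N_gt1: (1 < N)%N.
  rewrite ltn_neqAle N_gt0 andbT eq_sym.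
  by apply/eqP => N1; apply: d_pow; rewrite N1 !modz1.
set r := pdiv N in r2_le_N; have r_pr: prime r by apply: pdiv_prime.
have q_Fr: q%:R != 0 :> 'F_r.
  (* N = 0 in 'F_r, so Phi p N = 1 there, whereas q divides Phi p N. *)
  apply: contra_eq_neq (congr1 (intr : int -> 'F_r) PhiN) => q0.
  rewrite rmorph_Phi rmorphM /= -[q%:Z%:~R]/(q%:R) q0 mulr0.
  have /eqP -> : N%:Z%:~R == 0 :> 'F_r.
    by rewrite -(dvdz_pcharf (pchar_Fp r_pr)) dvdzE pdiv_dvd.
  rewrite /Phi -(prednK (prime_gt0 p_prime)) big_ord_recl expr0.
  rewrite big1 ?addr0 ?oner_eq0 //.
  by move=> i _; rewrite expr0n.
have [u Dw] : exists u : ring_of_integers K, w = (\pi_(ring_mod K N) u)%qT.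
  by exists (repr w); rewrite reprK.
have [y Phi_u] : exists y, Phi q (u ^+ k) = N%:R * y.
  by apply: Phi_pi_eq0; rewrite -pi_ring_modX -Dw.
have [m [m_prim size_m m_root]] :=
  primitive_annihilator (u ^+ k : ring_of_integers K).
have m_u : (map_poly intr m).[u ^+ k] = 0.
  pose val_rmorph : {rmorphism ring_of_integers K -> K} := val.
  apply: val_inj; rewrite -(horner_map val_rmorph) -map_poly_comp.
  rewrite (eq_map_poly (g := intr)); last first.
    by move=> z; apply: (rmorph_int val_rmorph).
  exact/eqP.
have mFr_neq0: map_poly (intr : int -> 'F_r) m != 0.
  by rewrite map_intr_Fp_eq0 // m_prim dvdz1 gtn_eqF ?prime_gt1.
have [|L [x [mx Phix]]] := common_root_ext (g := Phi q 'X) mFr_neq0.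
  rewrite -(map_Phi (intr : {rmorphism int -> 'F_r})).
  apply: (common_root_not_coprimep r_pr _ m_u (y := (N %/ r)%:R * y)).
    by move=> c; apply: natr_OK_not_unit; apply: prime_gt1.
  by rewrite map_Phi horner_Phi Phi_u mulrA -natrM mulnC divnK ?pdiv_dvd.
have := prime_lt_card_root q_prime q_Fr _ mFr_neq0 mx.
rewrite -horner_Phi -(map_Phi (in_alg L)) (eqP Phix) => /(_ erefl).
rewrite card_Fp // => q_lt.
have {}q_lt : (q < r ^ p)%N.
  apply: leq_trans q_lt _; rewrite leq_exp2l ?prime_gt1 //.
  rewrite -ltnS prednK; last by rewrite size_poly_gt0.
  apply: leq_trans (size_poly _ _) _; apply: leq_trans size_m _.
  by rewrite ltnS (dim_radical_ext (prime_gt0 p_prime) K_def).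
move: q_large; apply/negP; rewrite -leNgt.
(* N `^ (p / 2) is the p-th power of sqrt N, and r <= sqrt N. *)
have -> : N%:R `^ (p%:R / 2) = (N%:R `^ 2^-1) `^ p%:R :> R.
  by rewrite mulrC powRrM.
rewrite powR_mulrn ?powR_ge0 // lerBrDr natr1.
apply: (le_trans (y := (r ^ p)%:R)); first by rewrite ler_nat.
rewrite natrX lerXn2r ?nnegrE ?powR_ge0 //.
rewrite powR12_sqrt // -[leLHS]ger0_norm // -sqrtr_sqr -natrX.
by rewrite ler_wsqrtr // ler_nat.
Qed.
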